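(* There is an extra loop $Q$ of order $512$ such that $Q/Z(Q)$ is nonassociative.
   Context: A loop is a set with a binary operation having a two-sided identity $1$ and such that for all $a,b$ the equations $ax=b$ and $ya=b$ have unique solutions. In products, juxtaposition binds more tightly than $\cdot$. An extra loop is a loop that is both conjugacy closed and Moufang; equivalently (and this may be taken as the definition) a loop satisfying the identity $(xy\cdot z)\cdot x = x\cdot(y\cdot zx)$. The nucleus $N(Q)$ is the set of elements that associate with all pairs of elements of $Q$ in every position; the center $Z(Q)$ is the set of elements of $N(Q)$ that commute with every element of $Q$. It is a normal subloop, so the quotient loop $Q/Z(Q)$ is defined. *)

(* Defs.v *)
From HB Require Import structures.
From mathcomp Require Import all_boot.

Set Implicit Arguments.
Unset Strict Implicit.
Unset Printing Implicit Defensive.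

Local Open Scope group_scope.
Local Open Scope quotient_scope.

HB.mixin Record UMagma_isLoop Q of UMagma Q := {
  ldiv_uniq : forall a b : Q, exists! x : Q, a * x = b;
  rdiv_uniq : forall a b : Q, exists! y : Q, y * a = b
}.

#[short(type="loopType")]
HB.structure Definition Loop := {Q of UMagma_isLoop Q & UMagma Q}.

#[short(type="finLoopType")]
HB.structure Definition FinLoop := {Q of Loop Q & Finite Q}.

Definition extra_loop (Q : loopType) : Prop :=
  forall x y z : Q, ((x * y) * z) * x = x * (y * (z * x)).

Section LoopCancel.

Variable Q : loopType.
Implicit Types x y z : Q.

Lemma loop_mulgI x : injective (mul x).
Proof.
move=> y z eq_xyz; have [w [_ w_uniq]] := ldiv_uniq x (x * z).
by rewrite -(w_uniq y eq_xyz) (w_uniq z erefl).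
Qed.

Lemma loop_mulIg x : injective (mul^~ x).
Proof.
move=> y z eq_yzx; have [w [_ w_uniq]] := rdiv_uniq x (z * x).
by rewrite -(w_uniq y eq_yzx) (w_uniq z erefl).
Qed.

End LoopCancel.

Section Center.

Variable Q : finLoopType.
Implicit Types a x y z : Q.

Definition nucleus : {set Q} :=
  [set a | [forall x, forall y, [&& a * (x * y) == (a * x) * y,
                                    x * (a * y) == (x * a) * y
                                  & x * (y * a) == (x * y) * a]]].

Definition loop_center : {set Q} :=
  [set a in nucleus | [forall x, a * x == x * a]].

Lemma loop_centerP a :
  reflect [/\ forall x, x * a = a * x,
              forall x y, (a * x) * y = a * (x * y)
            & forall x y, x * (a * y) = a * (x * y)]
          (a \in loop_center).
Proof.
rewrite !inE.
apply: (iffP andP) => [[/forallP nuca /forallP cena] | [aC aA aCA]].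
  have aC x : x * a = a * x by apply/esym/eqP/cena.
  split=> // x y; have /forallP/(_ y)/and3P[/eqP aA /eqP maA _] := nuca x => //.
  by rewrite maA aC aA.
split; last by apply/forallP=> x; rewrite aC.
by apply/forallP=> x; apply/forallP=> y; rewrite !aC !aA !aCA !eqxx.
Qed.

Lemma loop_center1 : 1 \in loop_center.
Proof. by apply/loop_centerP; split=> *; rewrite !mul1g ?mulg1. Qed.

Lemma loop_centerM a b :
  a \in loop_center -> b \in loop_center -> a * b \in loop_center.
Proof.
move=> /loop_centerP[aC aA aCA] /loop_centerP[bC bA bCA].
apply/loop_centerP; split=> [x | x y | x y].
- by rewrite aCA aA bC.
- by rewrite !aA bA.
- by rewrite !aA aCA bCA.
Qed.

Lemma loop_centerV a :
  a \in loop_center -> exists2 b, b \in loop_center & a * b = 1.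
Proof.
move=> /loop_centerP[aC aA aCA]; have [b [ab1 _]] := ldiv_uniq a 1.
exists b => //; have abK x : a * (b * x) = x by rewrite -aA ab1 mul1g.
apply/loop_centerP; split=> [x | x y | x y]; apply: (@loop_mulgI _ a).
- by rewrite abK -aCA ab1 mulg1.
- by rewrite abK -aA abK.
- by rewrite abK -aCA abK.
Qed.

Definition center_rel : rel Q :=
  fun x y => [exists z in loop_center, y == x * z].

Lemma center_relP x y :
  reflect (exists2 z, z \in loop_center & y = x * z) (center_rel x y).
Proof. exact: 'exists_in_eqP. Qed.

Lemma center_rel_refl : reflexive center_rel.
Proof.
by move=> x; apply/center_relP; exists 1; rewrite ?mulg1 ?loop_center1.
Qed.

Lemma center_rel_trans : transitive center_rel.
Proof.
move=> y x z /center_relP[a Za ->] /center_relP[b Zb ->].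
apply/center_relP; exists (a * b); first exact: loop_centerM.
have [aC aA aCA] := loop_centerP _ Za.
by rewrite aCA aC aA.
Qed.

Lemma center_rel_sym : symmetric center_rel.
Proof.
suff sub x y : center_rel x y -> center_rel y x.
  by move=> x y; apply/idP/idP; exact: sub.
move=> /center_relP[a Za ->]; have [b Zb ab1] := loop_centerV Za.
apply/center_relP; exists b => //.
have [aC aA aCA] := loop_centerP _ Za.
by rewrite aC aA -aCA ab1 mulg1.
Qed.

Lemma center_relM x x' y y' :
  center_rel x x' -> center_rel y y' -> center_rel (x * y) (x' * y').
Proof.
move=> /center_relP[a Za ->] /center_relP[b Zb ->].
apply/center_relP; exists (a * b); first exact: loop_centerM.
have [aC aA aCA] := loop_centerP _ Za; have [bC bA bCA] := loop_centerP _ Zb.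
by rewrite aC bC !aA bCA aCA bC.
Qed.

Canonical center_equiv :=
  EquivRel center_rel center_rel_refl center_rel_sym center_rel_trans.

End Center.

(* The quotient loop Q / Z(Q): center_rel x y says that y lies in the coset
   x Z(Q), so the elements are the cosets of the center. *)
Definition center_quot (Q : finLoopType) := {eq_quot (@center_equiv Q)}.

Section CenterQuotient.

Variable Q : finLoopType.
Local Notation QZ := (center_quot Q).

HB.instance Definition _ : EqQuotient Q (@center_equiv Q) QZ :=
  EqQuotient.on QZ.
HB.instance Definition _ := Choice.on QZ.

Definition center_quot_one : QZ := lift_cst QZ 1.
Definition center_quot_mul : QZ -> QZ -> QZ := lift_op2 QZ (@mul Q).

Canonical pi_center_quot_one := PiConst center_quot_one.

Lemma pi_center_quot_mul :
  {morph \pi_QZ : x y / x * y >-> center_quot_mul x y}.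
Proof.
move=> x y; unlock center_quot_mul; apply/eqP; rewrite piE /=.
by apply: center_relM; rewrite -[center_rel _ _]eqmodE reprK.
Qed.

Canonical pi_center_quot_mul_morph := PiMorph2 pi_center_quot_mul.

Lemma center_quot_mul1g : left_id center_quot_one center_quot_mul.
Proof. by move=> x; rewrite -[x]reprK !piE mul1g. Qed.

Lemma center_quot_mulg1 : right_id center_quot_one center_quot_mul.
Proof. by move=> x; rewrite -[x]reprK !piE mulg1. Qed.

HB.instance Definition _ := hasMul.Build QZ center_quot_mul.
HB.instance Definition _ :=
  Magma_isUMagma.Build QZ center_quot_mul1g center_quot_mulg1.

Lemma pi_center_quotM (x y : Q) : \pi_QZ (x * y) = \pi_QZ x * \pi_QZ y.
Proof. exact: pi_center_quot_mul. Qed.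

Lemma center_quot_ldiv_uniq (a b : QZ) : exists! x : QZ, a * x = b.
Proof.
elim/quotW: a => a; elim/quotW: b => b; have [x [def_b _]] := ldiv_uniq a b.
exists (\pi_QZ x); split=> [|y]; first by rewrite -pi_center_quotM def_b.
elim/quotW: y => y; rewrite -pi_center_quotM => /esym/eqmodP/center_relP[z Zz].
have [zC zA zCA] := loop_centerP _ Zz.
rewrite -def_b zC -zCA => /loop_mulgI def_y.
by apply/eqmodP/center_relP; exists z; rewrite // zC.
Qed.

Lemma center_quot_rdiv_uniq (a b : QZ) : exists! y : QZ, y * a = b.
Proof.
elim/quotW: a => a; elim/quotW: b => b; have [x [def_b _]] := rdiv_uniq a b.
exists (\pi_QZ x); split=> [|y]; first by rewrite -pi_center_quotM def_b.
elim/quotW: y => y; rewrite -pi_center_quotM => /esym/eqmodP/center_relP[z Zz].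
have [zC zA zCA] := loop_centerP _ Zz.
rewrite -def_b zC -zA => /loop_mulIg def_y.
by apply/eqmodP/center_relP; exists z; rewrite // zC.
Qed.

HB.instance Definition _ :=
  UMagma_isLoop.Build QZ center_quot_ldiv_uniq center_quot_rdiv_uniq.

End CenterQuotient.

(* Main.v *)
Require Import Defs.
From HB Require Import structures.
From mathcomp Require Import all_boot ssralg finalg.

(** The loop is an extension of the elementary abelian group of order 16 by
    an abelian nucleus of order 32 on which that group acts nontrivially.

    For an abelian group V acting on an abelian group A and a map
    f : V * V -> A vanishing when one argument is 0, the product
    (x, a) (y, b) = (x + y, a.y + b + f x y) makes V * A a loop in which A is
    a nuclear subgroup; f measures the failure of associativity through its
    coboundary. Because A is nuclear, the extra law needs checking on V only,
    where it is a linear condition on f (extra_factor_ext).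

    A nonassociative quotient by the center requires an associator that does
    not commute with some element. Four generators v_1, ..., v_4 of V have
    four associators, e_i being that of the v_j with j <> i. The associators
    of an extra loop commute with their three arguments, so the simplest way
    to make them noncentral is to let e_i.v_i = e_i + t with t central.
    Taking for A the F_2-space with basis e_1, ..., e_4, t gives order
    16 * 32 = 512, and it remains to find f. All its coordinates come from
    P = x_1 x_2 x_3 x_4: on e_i, the part of bidegree (2, 1) of the partial
    derivative P_i evaluated at x + y; on t, the part of bidegree (1, 3) of
    P(x + y). The coboundary on e_i is then the polarization of P_i, which is
    1 on the three v_j with j <> i, so that e_4 is a noncentral associator. *)

Set Implicit Arguments.
Unset Strict Implicit.
Unset Printing Implicit Defensive.

Import GRing.Theory.
Local Open Scope ring_scope.

(** * Extensions by an abelian nucleus *)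

Record factor_system (V A : zmodType) := FactorSystem {
  fs_act : V -> A -> A;
  fs_cochain : V -> V -> A;
  fs_actB : forall v a b, fs_act v (a + b) = fs_act v a + fs_act v b;
  fs_act0 : forall a, fs_act 0 a = a;
  fs_actD : forall v w a, fs_act (v + w) a = fs_act w (fs_act v a);
  fs_cochain0l : forall v, fs_cochain 0 v = 0;
  fs_cochain0r : forall v, fs_cochain v 0 = 0
}.

Definition factor_ext (V A : zmodType) (F : factor_system V A) : Type :=
  (V * A)%type.

Section FactorExtension.

Variables (V A : finZmodType) (F : factor_system V A).

Local Notation act := (fs_act F).
Local Notation f := (fs_cochain F).
Local Notation E := (factor_ext F).

Implicit Types (v x y z : V) (a b c : A).

Lemma fs_actr0 v : act v 0 = 0.
Proof. by apply: (addrI (act v 0)); rewrite -fs_actB !addr0. Qed.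

Lemma fs_actNK v a : act v (act (- v) a) = a.
Proof. by rewrite -fs_actD addNr fs_act0. Qed.

Lemma fs_actKN v a : act (- v) (act v a) = a.
Proof. by rewrite -fs_actD addrN fs_act0. Qed.

Definition factor_ext_one : E := (0, 0).

Definition factor_ext_mul (p q : E) : E :=
  (p.1 + q.1, act q.1 p.2 + q.2 + f p.1 q.1).

Lemma factor_ext_mul1g : left_id factor_ext_one factor_ext_mul.
Proof.
by case=> x a; rewrite /factor_ext_mul /= fs_actr0 fs_cochain0l !add0r addr0.
Qed.

Lemma factor_ext_mulg1 : right_id factor_ext_one factor_ext_mul.
Proof.
by case=> x a; rewrite /factor_ext_mul /= fs_act0 fs_cochain0r !addr0.
Qed.

HB.instance Definition _ := Finite.copy E (V * A)%type.
HB.instance Definition _ := hasMul.Build E factor_ext_mul.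
HB.instance Definition _ :=
  Magma_isUMagma.Build E factor_ext_mul1g factor_ext_mulg1.

Lemma factor_ext_mulE (x y : V) (a b : A) :
  @mul E (x, a) (y, b) = (x + y, act y a + b + f x y).
Proof. by []. Qed.

Lemma factor_ext_ldiv_uniq (p q : E) : exists! r : E, mul p r = q.
Proof.
case: p q => [x a] [z c].
exists (z - x, c - f x (z - x) - act (z - x) a); split=> [|[y b]].
  by rewrite factor_ext_mulE addrC subrK [act _ _ + _]addrC !subrK.
rewrite factor_ext_mulE => -[<- <-].
by rewrite [x + y]addrC addrK addrK [act _ _ + _]addrC addrK.
Qed.

Lemma factor_ext_rdiv_uniq (p q : E) : exists! r : E, mul r p = q.
Proof.
case: p q => [x a] [z c].
exists (z - x, act (- x) (c - f (z - x) x - a)); split=> [|[y b]].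
  by rewrite factor_ext_mulE fs_actNK !subrK.
by rewrite factor_ext_mulE => -[<- <-]; rewrite !addrK fs_actKN.
Qed.

HB.instance Definition _ :=
  UMagma_isLoop.Build E factor_ext_ldiv_uniq factor_ext_rdiv_uniq.

Lemma card_factor_ext : #|{: E}| = (#|V| * #|A|)%N.
Proof. exact: card_prod. Qed.

(** The hypothesis is the extra law for the elements (x, 0), (y, 0), (z, 0).
    In general the terms coming from the three A-components agree on both
    sides: moving nuclear elements to the right past elements of V only
    applies the action, which depends on sums in V alone. *)
Lemma extra_factor_ext :
  (forall x y z,
      act (z + x) (f x y) + act x (f (x + y) z) + f (x + y + z) x
      = f z x + f y (z + x) + f x (y + (z + x))) ->
  extra_loop E.
Proof.
move=> extraF [x a] [y b] [z c]; do ![rewrite factor_ext_mulE /=].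
congr pair; first by rewrite !addrA.
rewrite !fs_actB -!fs_actD !addrA.
have /(congr1 (+%R (act (y + z + x) a + act (z + x) b + act x c + a))) :=
  extraF x y z.
by rewrite !addrA => <-; rewrite (ACl (1*2*4*6*3*5*7)).
Qed.

End FactorExtension.

(** * Nonassociativity modulo the center *)

(** If c is the left quotient of (x y) z by x (y z), associativity modulo the
    center would put c in the center. *)
Lemma center_quot_nonassoc (Q : finLoopType) (x y z c w : Q) :
    (mul (mul x (mul y z)) c = mul (mul x y) z)%g ->
    mul c w <> mul w c ->
  ~ associative (@mul (center_quot Q)).
Proof.
move=> assoc_c nC_cw assocQZ.
have := assocQZ (\pi_(center_quot Q) x)%qT (\pi_(center_quot Q) y)%qT
                (\pi_(center_quot Q) z)%qT.
rewrite -!pi_center_quotM => /eqmodP/center_relP[c' Zc'].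
rewrite -assoc_c => /loop_mulgI def_c; apply: nC_cw; rewrite def_c.
by have [cC _ _] := loop_centerP _ Zc'; rewrite cC.
Qed.

(** * The loop of order 512 *)

Definition F2_4 : Type := (bool * bool * bool * bool)%type.

HB.instance Definition _ := Finite.copy F2_4 (bool * bool * bool * bool)%type.
HB.instance Definition _ :=
  GRing.Zmodule.copy F2_4 (bool * bool * bool * bool)%type.

(** Coordinates with respect to e_1, ..., e_4, t. *)
Definition F2_5 : Type := (F2_4 * bool)%type.

HB.instance Definition _ := Finite.copy F2_5 (F2_4 * bool)%type.
HB.instance Definition _ := GRing.Zmodule.copy F2_5 (F2_4 * bool)%type.

Definition dot4 (u v : F2_4) : bool :=
  let: (u1, u2, u3, u4) := u in let: (v1, v2, v3, v4) := v in
  u1 && v1 (+) u2 && v2 (+) u3 && v3 (+) u4 && v4.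

(** The action e_i.v = e_i + v_i t, t.v = t. *)
Definition shear (v : F2_4) (a : F2_5) : F2_5 := (a.1, a.2 (+) dot4 a.1 v).

(** The part of bidegree (2, 1) of (x1 + y1) (x2 + y2) (x3 + y3). *)
Definition cubic21 (x1 x2 x3 y1 y2 y3 : bool) : bool :=
  (x1 && x2 && y3) (+) (x1 && x3 && y2) (+) (x2 && x3 && y1).

Definition quartic_cochain (x y : F2_4) : F2_5 :=
  let: (x1, x2, x3, x4) := x in let: (y1, y2, y3, y4) := y in
  (cubic21 x2 x3 x4 y2 y3 y4,
   cubic21 x1 x3 x4 y1 y3 y4,
   cubic21 x1 x2 x4 y1 y2 y4,
   cubic21 x1 x2 x3 y1 y2 y3,
   (x1 && y2 && y3 && y4) (+) (x2 && y1 && y3 && y4)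
     (+) (x3 && y1 && y2 && y4) (+) (x4 && y1 && y2 && y3)).

Definition F2_4_enum : seq F2_4 :=
  let b2 := [:: false; true] in
  [seq (x, d) | x <- [seq (y, c) | y <- [seq (a, b) | a <- b2, b <- b2],
                                   c <- b2], d <- b2].

(** Reduces an identity in three vectors to an evaluation over an explicit
    list, which computes. *)
Lemma all3_F2_4 (P : F2_4 -> F2_4 -> F2_4 -> bool) :
  all (fun x => all (fun y => all (P x y) F2_4_enum) F2_4_enum) F2_4_enum ->
  forall x y z, P x y z.
Proof.
have mem_enum x : x \in F2_4_enum by case: x => [[[[][]][]][]].
move=> /allP Pxyz x y z.
by have /allP/(_ y (mem_enum y))/allP/(_ z (mem_enum z)) := Pxyz x (mem_enum x).
Qed.

Lemma dot4Dl u v w : dot4 (u + v) w = dot4 u w (+) dot4 v w.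
Proof. by apply/eqP; move: u v w; apply: all3_F2_4; vm_compute. Qed.

Lemma dot4Dr u v w : dot4 u (v + w) = dot4 u v (+) dot4 u w.
Proof. by apply/eqP; move: u v w; apply: all3_F2_4; vm_compute. Qed.

Lemma shearB v a b : shear v (a + b) = shear v a + shear v b.
Proof. by rewrite /shear dot4Dl /= addbACA. Qed.

Lemma shear0 a : shear 0 a = a.
Proof.
by case: a => [[[[a1 a2] a3] a4] a]; rewrite /shear /= !andbF !addbF.
Qed.

Lemma shearD v w a : shear (v + w) a = shear w (shear v a).
Proof. by rewrite /shear dot4Dr addbA. Qed.

Lemma quartic_cochain0l v : quartic_cochain 0 v = 0.
Proof. by case: v => [[[[][]][]][]]. Qed.

Lemma quartic_cochain0r v : quartic_cochain v 0 = 0.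
Proof. by case: v => [[[[][]][]][]]. Qed.

Definition quartic_system : factor_system F2_4 F2_5 :=
  FactorSystem shearB shear0 shearD quartic_cochain0l quartic_cochain0r.

(** The identity is a cancellation of polarizations over F_2. On e_i, with F
    the part of bidegree (2, 1) of P_i and T the trilinear polarization of
    P_i, one has F (x + y, z) = F (x, z) + F (y, z) + T (x, y, z); after
    expansion every value of F occurs twice, T (x, y, z) occurs twice, and T
    vanishes when two arguments coincide. On t, let P_31, P_13 and
    P_211 (x; y, z) be the polarizations of P of the given multidegrees. The
    action contributes P_31 (x, y) + P_31 (x, z) + P_211 (x; y, z) +
    P_211 (y; x, z), and expanding the values of P_13 at sums makes every
    term occur an even number of times. *)
Lemma quartic_cochain_extra x y z :
  shear (z + x) (quartic_cochain x y) + shear x (quartic_cochain (x + y) z)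
    + quartic_cochain (x + y + z) x
  = quartic_cochain z x + quartic_cochain y (z + x)
    + quartic_cochain x (y + (z + x)).
Proof. by apply/eqP; move: x y z; apply: all3_F2_4; vm_compute. Qed.

Definition quartic_loop : finLoopType := factor_ext quartic_system.

Local Close Scope ring_scope.

Theorem mainTheorem5 :
  exists Q : finLoopType,
    [/\ extra_loop Q, #|Q| = 512 & ~ associative (@mul (center_quot Q))].
Proof.
exists quartic_loop; split.
- exact: (@extra_factor_ext _ _ quartic_system) quartic_cochain_extra.
- by rewrite card_factor_ext !card_prod card_bool.
pose v1 : F2_4 := (true, false, false, false).
pose v2 : F2_4 := (false, true, false, false).
pose v3 : F2_4 := (false, false, true, false).
pose v4 : F2_4 := (false, false, false, true).
pose e4 : F2_5 := (v4, false).
pose emb v : quartic_loop := (v, 0%R).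
(* The associator e_4 of v_1, v_2, v_3 becomes e_4 + t under v_4. *)
apply: (@center_quot_nonassoc quartic_loop
          (emb v1) (emb v2) (emb v3) (0%R, e4) (emb v4)).
  by vm_compute.
by vm_compute.
Qed.
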